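(* For every integer $n \ge 9$ of the form $n = 5k + 4$ with $k$ a positive integer, we have $\mathbf{car}(n, 3) \ge 4^{(n - 4)/5}$.
   Context: A partial deterministic finite (semi-)automaton (partial DFA) is a triple $\mathcal{A} = (Q, \Sigma, \delta)$ with $Q$ a finite set of states, $\Sigma$ a finite alphabet, and $\delta \colon Q \times \Sigma \rightharpoonup Q$ a partial transition function, extended to words $\delta\colon Q \times \Sigma^* \rightharpoonup Q$ in the usual way ($\delta(q,\varepsilon)=q$, $\delta(q, wa) = \delta(\delta(q,w),a)$, undefined if any step is undefined). A word $w \in \Sigma^*$ is carefully synchronising for $\mathcal{A}$ if there is a state $q \in Q$ such that $\delta(p, w)$ is defined and equals $q$ for every $p \in Q$. $\mathbf{car}(n, m)$ denotes the maximum, over all partial DFAs with $n$ states and $m$ letters that admit at least one carefully synchronising word, of the length of a shortest carefully synchronising word. *)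

(* Defs.v *)
From mathcomp Require Import all_boot.
From Stdlib Require Import ClassicalEpsilon.

Set Implicit Arguments.
Unset Strict Implicit.
Unset Printing Implicit Defensive.

Definition pdfa (n m : nat) := {ffun 'I_n -> {ffun 'I_m -> option 'I_n}}.

Definition delta_word n m (d : pdfa n m) (q : 'I_n) (w : seq 'I_m) : option 'I_n :=
  foldl (fun oq a => obind (fun p => d p a) oq) (Some q) w.

Definition careful_sync n m (d : pdfa n m) (w : seq 'I_m) : bool :=
  [exists q : 'I_n, [forall p : 'I_n, delta_word d p w == Some q]].

Definition sync_of_len n m (d : pdfa n m) (l : nat) : bool :=
  [exists t : l.-tuple 'I_m, careful_sync d t].

Definition carefully_synchronisable n m (d : pdfa n m) : Prop :=
  exists w : seq 'I_m, careful_sync d w.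

Lemma sync_len_ex n m (d : pdfa n m) :
  carefully_synchronisable d -> exists l, sync_of_len d l.
Proof.
case=> w hw; exists (size w); apply/existsP; exists (in_tuple w); exact: hw.
Qed.

(* Length of a shortest carefully synchronising word (0 if there is none;
   such automata are excluded from the maximum below anyway). *)
Definition shortest_cs n m (d : pdfa n m) : nat :=
  match excluded_middle_informative (carefully_synchronisable d) with
  | left H => ex_minn (sync_len_ex H)
  | right _ => 0
  end.

Definition carefully_synchronisableb n m (d : pdfa n m) : bool :=
  if excluded_middle_informative (carefully_synchronisable d) then true else false.

Definition car (n m : nat) : nat :=
  \max_(d : pdfa n m | carefully_synchronisableb d) shortest_cs d.

(* Main.v *)
(* A 3-letter automaton implements a base-4 counter on a rotating tape.  A
   configuration holds one token per tape cell: k - 1 digits and one marker, the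
   token of a digit recording both its current position and its value.  Two
   letters rotate the tape by one position, "with carry" and "without carry".  A
   digit leaving the last position is incremented if the letter is a carry, and
   on leaving position 0 one step later it tolerates only the letter announcing
   whether it has just overflowed; the marker leaving position 0 tolerates only
   a carry, which starts the next increment.  Hence the only freedom is to apply
   the third letter, a reset.  Tokens merge only when a carry reaches the marker,
   which takes k * 4^(k-1) letters, and k * 4^(k-1) >= 4^k for k >= 4.  For k <= 3
   two cycles of coprime lengths, which can only merge when both are at their
   last state, are enough. *)
Require Import Defs.
From mathcomp Require Import all_boot.
From mathcomp Require Import zmodp zify.
From Stdlib Require Import ClassicalEpsilon.

Set Implicit Arguments.
Unset Strict Implicit.
Unset Printing Implicit Defensive.

(** * Runs over arbitrary types and a criterion for lower bounds on [car] *)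

Definition run (Q X : Type) (d : Q -> X -> option Q) (q : Q) (w : seq X) :=
  foldl (fun oq a => obind (fun p => d p a) oq) (Some q) w.

Lemma run_rcons (Q X : Type) (d : Q -> X -> option Q) q w a :
  run d q (rcons w a) = obind (fun p => d p a) (run d q w).
Proof. by rewrite /run foldl_rcons. Qed.

Lemma run_rcons_some (Q X : Type) (d : Q -> X -> option Q) q w a p :
  run d q w = Some p -> run d q (rcons w a) = d p a.
Proof. by rewrite run_rcons => ->. Qed.

Lemma run_cat (Q X : Type) (d : Q -> X -> option Q) q w1 w2 :
  run d q (w1 ++ w2) = obind (fun p => run d p w2) (run d q w1).
Proof.
rewrite /run foldl_cat; case: (foldl _ _ w1) => //=.
by elim: w2 => //= a w2.
Qed.

Definition synchronises (Q X : Type) (d : Q -> X -> option Q) (w : seq X) :=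
  exists q, forall p, run d p w = Some q.

(** Numbering states and letters by [enum_rank] lets the automata below live on structured finite
    types instead of ordinals. *)
Lemma leq_car (Q X : finType) (d : Q -> X -> option Q) (L : nat) :
  (exists w, synchronises d w) ->
  (forall w, synchronises d w -> L <= size w) ->
  L <= car #|Q| #|X|.
Proof.
move=> [w0 [q0 sync0]] minL.
pose d' : pdfa #|Q| #|X| :=
  [ffun i => [ffun a => omap enum_rank (d (enum_val i) (enum_val a))]].
have runE p w :
  delta_word d' (enum_rank p) (map enum_rank w) = omap enum_rank (run d p w).
  elim/last_ind: w => // w a IH.
  rewrite map_rcons run_rcons /delta_word foldl_rcons -/(delta_word _ _ _) IH.
  by case: (run d p w) => //= q; rewrite !ffunE !enum_rankK.
have cs : carefully_synchronisable d'.
  exists (map enum_rank w0); apply/existsP; exists (enum_rank q0).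
  by apply/forallP => p; rewrite -[p]enum_valK runE sync0.
have csb : carefully_synchronisableb d'.
  by rewrite /carefully_synchronisableb; case: excluded_middle_informative.
apply: leq_trans (leq_bigmax_cond _ csb).
rewrite /shortest_cs; case: excluded_middle_informative => // H.
case: ex_minnP => l /existsP[t /existsP[q /forallP sync]] _.
rewrite -(size_tuple t) -(size_map enum_val); apply: minL.
exists (enum_val q) => p.
have tE : tval t = map enum_rank (map enum_val t).
  by rewrite -map_comp map_id_in // => a _ /=; rewrite enum_valK.
have /eqP := sync (enum_rank p).
by rewrite [X in delta_word _ _ X]tE runE; case: run => //= r [<-]; rewrite enum_rankK.
Qed.

(* The configuration [range (tok t)] is followed forward in time: a letter that
   is defined on it moves the clock [t] by at most one. *)
Lemma leq_size_sync (Q X I : Type) (d : Q -> X -> option Q)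
    (tok : nat -> I -> Q) (T : nat) :
  (forall t a, t.+1 < T -> (forall i, d (tok t i) a) ->
     exists2 t', t' <= t.+1 & forall i, exists j, d (tok t j) a = Some (tok t' i)) ->
  (forall t, exists i j, tok t i <> tok t j) ->
  forall w, synchronises d w -> T <= size w.
Proof.
move=> step neq w [q syncq]; rewrite leqNgt; apply/negP => ltT.
have [t _ reach] : exists2 t, t <= size w &
    forall i, exists p, run d p w = Some (tok t i).
  have: forall p, run d p w by move=> p; rewrite syncq.
  elim/last_ind: w ltT {syncq} => [|w a IH] ltT def.
    by exists 0 => // i; exists (tok 0 i).
  rewrite size_rcons in ltT *.
  have [|t letw reach] := IH (ltnW ltT).
    by move=> p; move: (def p); rewrite run_rcons; case: run.
  have [|i|t' lett' reach'] := step t a; first exact: leq_ltn_trans ltT.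
    by have [p Ep] := reach i; move: (def p); rewrite run_rcons Ep.
  exists t' => [|i]; first exact: leq_trans lett' _.
  have [j Ej] := reach' i; have [p Ep] := reach j.
  by exists p; rewrite run_rcons Ep.
have [i [j []]] := neq t.
have [p] := reach i; rewrite syncq => -[<-].
by have [p'] := reach j; rewrite syncq => -[<-].
Qed.

Lemma ordS_inZp n s : ordS (inZp s : 'I_n.+1) = inZp s.+1.
Proof. by apply: val_inj; rewrite /= -addn1 modnDml addn1. Qed.

Lemma ord_pred_inZpS n s : ord_pred (inZp s.+1 : 'I_n.+1) = inZp s.
Proof. by rewrite -ordS_inZp ordSK. Qed.

(** * Two coprime cycles *)

Definition cycles_step p q (x : 'I_p.+1 + 'I_q.+1) (a : option bool) :=
  match a, x with
  | None, inl _ => Some (inl ord0)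
  | None, inr _ => Some (inr ord0)
  | Some false, inl i => Some (inl (ordS i))
  | Some false, inr j => Some (inr (ordS j))
  | Some true, inl i => if i == ord_max then Some (inl ord0) else None
  | Some true, inr j => if j == ord_max then Some (inl ord0) else None
  end.

Lemma inZp_eq_max n t : (inZp t == ord_max :> 'I_n.+1) = (n.+1 %| t.+1).
Proof.
rewrite -val_eqE /= /dvdn -[t.+1]addn1 -modnDml addn1.
have := ltn_pmod t (ltn0Sn n); move: (t %% n.+1) => x; rewrite ltnS leq_eqVlt.
case/predU1P => [->|ltxn]; first by rewrite modnn !eqxx.
by rewrite modn_small // ltn_eqF.
Qed.

(** After [t] rotations the cycles stand at [t] modulo their lengths; by coprimality both are at
    their last state only when the product of the lengths divides [t.+1]. *)
Lemma leq_car_cycles p q : coprime p.+1 q.+1 ->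
  p.+1 * q.+1 <= car (p.+1 + q.+1) 3.
Proof.
move=> co.
have -> : p.+1 + q.+1 = #|{: 'I_p.+1 + 'I_q.+1}| by rewrite card_sum !card_ord.
have -> : 3 = #|{: option bool}| by rewrite card_option card_bool.
pose tok t (b : bool) : 'I_p.+1 + 'I_q.+1 :=
  if b then inr (inZp t) else inl (inZp t).
apply: (@leq_car _ _ (@cycles_step p q)).
- have [T TE] : exists T, T.+1 = p.+1 * q.+1 by eexists.
  exists (None :: rcons (nseq T (Some false)) (Some true)).
  exists (inl ord0) => x; rewrite -cat1s run_cat.
  have [b ->] : exists b, run (@cycles_step p q) x [:: None] = Some (tok 0 b).
    by case: x => i; [exists false|exists true];
      congr (Some (_ _)); apply: val_inj; rewrite /= mod0n.
  rewrite [obind _ _]/=.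
  have rot m : run (@cycles_step p q) (tok 0 b) (nseq m (Some false)) =
               Some (tok m b).
    elim: m => // m IH; rewrite -[m.+1]addn1 nseqD cats1 run_rcons IH addn1 /tok.
    by case: (b) => /=; rewrite ordS_inZp.
  rewrite run_rcons rot /tok; case: (b) => /=; rewrite inZp_eq_max TE.
    by rewrite dvdn_mull.
  by rewrite dvdn_mulr.
- apply: (leq_size_sync (tok := tok)) => [t [[]|] ltT def|t].
  + have := def true; have := def false; rewrite /= !inZp_eq_max.
    case: ifP => // dp _; case: ifP => // dq _.
    have : p.+1 * q.+1 %| t.+1 by rewrite Gauss_dvd // dp.
    by move/dvdn_leq => /(_ isT); rewrite leqNgt ltT.
  + by exists t.+1 => // -[]; [exists true|exists false]; rewrite /= ordS_inZp.
  + exists 0 => // -[]; [exists true|exists false];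
      by congr (Some (_ _)); apply: val_inj; rewrite /= mod0n.
  + by exists true, false.
Qed.

(** * A base-4 counter on a rotating tape *)

Section Counter.

Variable k : nat.
Local Notation K := k.+2.
Local Notation state := ('I_K * option 'I_4 + 'I_4)%type.

(* [inl (i, None)] is the marker at position [i], [inl (i, Some c)] the digit [c]
   at position [i], and every [inr _] a digit at position 0 that has just
   overflowed.  The letters [None], [Some false] and [Some true] are the reset and
   the rotations without and with carry. *)
Definition initial (i : 'I_K) : state :=
  inl (i, if i == ord0 then None else Some ord0).

Definition counter_step (x : state) (a : option bool) : option state :=
  match a, x with
  | None, inl (i, _) => Some (initial (ord_pred i))
  | None, inr _ => Some (initial (ord_pred ord0))
  | Some false, inl (i, c) =>
      if (i == ord0) && (c == None) then None else Some (inl (ordS i, c))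
  | Some false, inr _ => None
  | Some true, inl (i, None) =>
      Some (inl (if i == ord_max then (ordS ord0, Some ord0) else (ordS i, None)))
  | Some true, inl (i, Some c) =>
      if i == ord0 then None
      else if i == ord_max then
        Some (if c == ord_max then inr ord0 else inl (ord0, Some (ordS c)))
      else Some (inl (ordS i, Some c))
  | Some true, inr _ => Some (inl (ordS ord0, Some ord0))
  end.

(* The digit in cell [e] has weight [4 ^ (k.+1 - e)] and has been incremented
   [(t + e) %/ K] times by time [t]; the marker is cell 0. *)
Definition token (t : nat) (e : 'I_K) : state :=
  let s := t + e in
  if e == ord0 then inl (inZp s, None)
  else if (K %| s) && (4 ^ (K - e) %| s %/ K) then inr ord0
  else inl (inZp s, Some (inZp (s %/ K %/ 4 ^ (k.+1 - e)))).

(* At time [t] the digit of weight [4 ^ (t %% K)] leaves the last position; when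
   [t %% K = k.+1], it is the marker. *)
Definition carry (t : nat) : bool := 4 ^ (t %% K) %| (t %/ K).+1.

Lemma token0 e : token 0 e = initial e.
Proof.
rewrite /token /initial add0n.
have -> : inZp e = e by apply: val_inj; rewrite /= modn_small.
case: ifP => // /negbT e0; rewrite divn_small // div0n gtnNdvd ?lt0n //=.
by congr (inl (_, Some _)); apply: val_inj.
Qed.

Lemma inZp_eq0 n t : (inZp t == ord0 :> 'I_n.+1) = (n.+1 %| t).
Proof. by rewrite -val_eqE. Qed.

Lemma digit_step t (e : 'I_K) : e != ord0 ->
  counter_step (token t e) (Some (carry t)) = Some (token t.+1 e).
Proof.
move=> e0; have e_gt0 : 0 < e by rewrite lt0n.
have leK := ltn_ord e.
rewrite /token (negPf e0) /carry addSn.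
have rK : t %% K < K by rewrite ltn_mod.
move: (divn_eq t K); move: (t %/ K) (t %% K) rK => u r rK tE.
have sE : t + e = u * K + (r + e) by rewrite tE addnA.
(* In the current lap, cell [e] has not yet reached position 0, is past it, or is exactly there. *)
have [ltK|gtK|eqK] := ltngtP (r + e) K.
- have sq : (t + e) %/ K = u by rewrite sE divnMDl // divn_small ?addn0.
  have sn : (K %| t + e) = false.
    by rewrite sE dvdn_addr ?dvdn_mull // gtnNdvd ?addn_gt0 ?e_gt0 ?orbT.
  rewrite sn sq andFb.
  have [eqK1|neK1] := eqVneq (r + e).+1 K.
  + have sE' : (t + e).+1 = u.+1 * K by rewrite sE -addnS eqK1 mulSn addnC.
    have dS : K %| (t + e).+1 by rewrite sE' dvdn_mull.
    have -> : k.+1 - e = r by lia.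
    have -> : K - e = r.+1 by lia.
    rewrite dS sE' mulnK // -sE' andTb.
    have -> : inZp (t + e).+1 = ord0 :> 'I_K by apply/eqP; rewrite inZp_eq0.
    (* A digit hit by a carry overflows exactly when its incremented count is a multiple of 4. *)
    have wrapE : 4 ^ r %| u.+1 ->
        (4 ^ r.+1 %| u.+1) = (4 %| (u %/ 4 ^ r).+1).
      by move=> cr; rewrite expnS -dvdn_divRL // divnS ?expn_gt0 // cr.
    rewrite divnS ?expn_gt0 //.
    case: (boolP (4 ^ r %| u.+1)) => [carried|ncarried] /=.
    * rewrite inZp_eq0 sn inZp_eq_max dS inZp_eq_max wrapE //.
      by case: ifP; rewrite // ordS_inZp.
    * have -> : (4 ^ r.+1 %| u.+1) = false.
        by apply: contraNF ncarried; apply: dvdn_trans; rewrite dvdn_exp2l.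
      rewrite andbF ordS_inZp; congr (Some (inl (_, _))).
      by apply/eqP; rewrite inZp_eq0.
  + have sn' : (K %| (t + e).+1) = false.
      rewrite sE -addnS dvdn_addr ?dvdn_mull // gtnNdvd //.
      by rewrite ltn_neqAle neK1.
    have sq' : (t + e).+1 %/ K = u by rewrite divnS // sn' sq.
    rewrite sn' andFb sq'.
    by case: (4 ^ r %| u.+1) => /=; rewrite !inZp_eq0 ?inZp_eq_max sn ?sn' ?ordS_inZp.
- have eq' : r + e = K + (r + e - K) by rewrite subnKC // ltnW.
  have sE' : t + e = u.+1 * K + (r + e - K).
    by rewrite sE {1}eq' addnA -mulSnr.
  have r0 : 0 < r + e - K by rewrite subn_gt0.
  have r1 : (r + e - K).+1 < K by lia.
  have sn : (K %| t + e) = false.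
    by rewrite sE' dvdn_addr ?dvdn_mull // gtnNdvd // ltnW.
  have sn' : (K %| (t + e).+1) = false.
    by rewrite sE' -addnS dvdn_addr ?dvdn_mull // gtnNdvd.
  rewrite sn sn' divnS // sn' !andFb.
  by case: (4 ^ r %| u.+1) => /=; rewrite !inZp_eq0 ?inZp_eq_max sn ?sn' ?ordS_inZp.
(* At position 0 the overflow condition of the digit is the same divisibility as [carry t], so this
   letter is the tolerated one. *)
- have sE' : t + e = u.+1 * K by rewrite sE eqK mulSnr.
  have sn : K %| t + e by rewrite sE' dvdn_mull.
  have sn' : (K %| (t + e).+1) = false.
    by rewrite -[(t + e).+1]addn1 dvdn_addr // dvdn1.
  have sq : (t + e) %/ K = u.+1 by rewrite sE' mulnK.
  have Ke : K - e = r by lia.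
  rewrite sn sn' divnS // sn' sq Ke andTb andFb.
  have z : inZp (t + e) = ord0 :> 'I_K by apply/eqP; rewrite inZp_eq0.
  rewrite -ordS_inZp z.
  case: (boolP (4 ^ r %| u.+1)) => carried /=; last by [].
  congr (Some (inl (_, Some _))).
  have rE : r = (k.+1 - e).+1 by rewrite -Ke; lia.
  apply/esym/eqP; rewrite inZp_eq0 dvdn_divRL -?expnS -?rE //.
  by apply: dvdn_trans carried; rewrite dvdn_exp2l ?rE.
Qed.

Lemma tokenM t : token t ord0 = inl (inZp t, None).
Proof. by rewrite /token addn0. Qed.

Lemma last_phase t : K %| t.+1 -> t %% K = k.+1.
Proof. by rewrite -inZp_eq_max => /eqP/(congr1 val). Qed.

Lemma marker_step t : t.+1 < K * 4 ^ k.+1 ->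
  counter_step (token t ord0) (Some (carry t)) = Some (token t.+1 ord0).
Proof.
move=> ltT; rewrite !tokenM -ordS_inZp.
case carryt: (carry t) => /=.
  rewrite inZp_eq_max; case: ifP => // dK.
  (* A carry meeting the marker at the last position needs [4 ^ k.+1] to divide [t.+1 %/ K], which
     is too small. *)
  move: carryt; rewrite /carry last_phase // => /dvdn_leq => /(_ isT).
  rewrite leqNgt -(ltn_pmul2l (ltn0Sn k.+1)).
  have -> : (t %/ K).+1 = t.+1 %/ K by rewrite divnS // dK.
  by rewrite mulnC divnK // ltT.
rewrite inZp_eq0; case: ifP => // /andP[dK _].
by move: carryt; rewrite /carry (eqP dK) dvd1n.
Qed.

Lemma marker_overflow t : t.+1 = K * 4 ^ k.+1 ->
  counter_step (token t ord0) (Some (carry t)) =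
  Some (inl (ordS ord0, Some ord0)).
Proof.
move=> tE; have dK : K %| t.+1 by rewrite tE dvdn_mulr.
have -> : carry t = true.
  have -> : carry t = (4 ^ k.+1 %| t.+1 %/ K).
    by rewrite /carry last_phase // divnS // dK.
  by rewrite tE mulKn // dvdnn.
by rewrite tokenM /= inZp_eq_max dK.
Qed.

(** The cell at position 0 decides the letter: it is the marker if [K] divides [t], and otherwise
    the digit in cell [K - t %% K]. *)
Lemma carry_forced t b :
  (forall e, counter_step (token t e) (Some b)) -> b = carry t.
Proof.
move=> def; have [dK|ndK] := boolP (K %| t).
  have -> : carry t by rewrite /carry (eqP dK) dvd1n.
  by move: (def ord0); rewrite tokenM; case: b {def} => //=; rewrite inZp_eq0 dK.
have r0 : 0 < t %% K by rewrite lt0n.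
have ltK : K - t %% K < K by rewrite ltn_subrL r0.
have rK : t %% K <= K by rewrite ltnW // ltn_mod.
have := def (Ordinal ltK); rewrite /token -val_eqE /=.
have tE : t + (K - t %% K) = (t %/ K).+1 * K.
  by rewrite {1}(divn_eq t K) -addnA subnKC // mulSnr.
rewrite subn_eq0 leqNgt ltn_mod /= subKn // tE mulnK // dvdn_mull //=.
rewrite -/(carry t); case: (carry t); case: b {def} => //=.
by rewrite inZp_eq0 dvdn_mull.
Qed.

Lemma reset_token t e :
  counter_step (token t e) None = Some (initial (ord_pred (inZp (t + e)))).
Proof.
rewrite /token; case: ifP => // _; case: ifP => // /andP[dK _].
by have -> : inZp (t + e) = ord0 :> 'I_K by apply/eqP; rewrite inZp_eq0.
Qed.

Definition lap : seq (option bool) :=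
  rcons (mkseq (fun t => Some (carry t)) (K * 4 ^ k.+1)) None.

(* A complete count moves every digit back to its cell but merges the marker
   with the token next to it; as a reset also shifts all cells by one, repeated
   laps absorb the tokens one after the other. *)
Lemma run_lap (e : 'I_K) :
  run counter_step (initial e) lap = Some (initial (inord e.-1)).
Proof.
rewrite /lap -token0.
have [->|e0] := eqVneq e ord0.
  have marker m : m < K * 4 ^ k.+1 ->
      run counter_step (token 0 ord0) (mkseq (fun t => Some (carry t)) m) =
      Some (token m ord0).
    elim: m => // m IH ltT; rewrite mkseqS run_rcons IH ?(ltnW ltT) //.
    exact: marker_step.
  have [T TE] : exists T, T.+1 = K * 4 ^ k.+1.
    by exists (K * 4 ^ k.+1).-1; rewrite prednK // muln_gt0 expn_gt0.
  rewrite (run_rcons_some _ (p := inl (ordS ord0, Some ord0))).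
    by rewrite /= ordSK; congr (Some (initial _)); apply: val_inj; rewrite /= inordK.
  rewrite -TE mkseqS (run_rcons_some _ (marker T _)) -?TE //.
  exact: marker_overflow.
have digit m : run counter_step (token 0 e) (mkseq (fun t => Some (carry t)) m) =
               Some (token m e).
  by elim: m => // m IH; rewrite mkseqS run_rcons IH; apply: digit_step.
rewrite (run_rcons_some _ (digit _)) reset_token; congr (Some (initial _)).
have e1 : 0 < e by rewrite lt0n.
have -> : inZp (K * 4 ^ k.+1 + e) = inZp e.-1.+1 :> 'I_K.
  by apply: val_inj; rewrite /= prednK // mulnC modnMDl.
have lte : e.-1 < K by rewrite (leq_ltn_trans (leq_pred _)).
by rewrite ord_pred_inZpS; apply: val_inj; rewrite /= inordK // modn_small.
Qed.

Lemma counter_synchronisable : exists w, synchronises counter_step w.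
Proof.
exists (None :: flatten (nseq K lap)); exists (initial ord0) => x.
rewrite -cat1s run_cat.
have [e ->] : exists e, run counter_step x [:: None] = Some (initial e).
  by case: x => [[i c]|c]; eexists.
have laps m : run counter_step (initial e) (flatten (nseq m lap)) =
              Some (initial (inord (e - m))).
  elim: m => [|m IH]; first by rewrite subn0 inord_val.
  rewrite -[m.+1]addn1 nseqD flatten_cat run_cat IH /= cats0 run_lap.
  by rewrite inordK ?(leq_ltn_trans (leq_subr _ _)) // addn1 subnS.
rewrite -[LHS]/(run counter_step (initial e) (flatten (nseq K lap))) laps.
(* By definition [e <= K] is the equation [e - K == 0]. *)
rewrite (eqP (ltnW (ltn_ord e))).
by congr (Some (initial _)); apply: val_inj; rewrite /= inordK.
Qed.

Lemma leq_car_counter : K * 4 ^ k.+1 <= car (5 * K + 4) 3.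
Proof.
suff : K * 4 ^ k.+1 <= car #|{: state}| #|{: option bool}|.
  by rewrite card_sum card_prod !card_option card_bool !card_ord [K * 5]mulnC.
apply: leq_car counter_synchronisable _.
apply: (leq_size_sync (tok := token)) => [t [b|] ltT def|t].
- exists t.+1 => // e; exists e; rewrite (carry_forced def).
  by have [->|e0] := eqVneq e ord0; rewrite ?marker_step ?digit_step.
(* Modulo [K] the factor [k.+1] is -1, so this index is [e + 1 - t], the cell that the reset sends
   to [initial e]. *)
- exists 0 => // e; exists (inZp (t * k.+1 + e.+1)).
  rewrite reset_token token0; congr (Some (initial _)).
  have -> : inZp (t + (inZp (t * k.+1 + e.+1) : 'I_K)) = inZp (t * K + e).+1 :> 'I_K.
    by apply: val_inj; rewrite /= modnDmr addnA -mulnS addnS.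
  by rewrite ord_pred_inZpS; apply: val_inj; rewrite /= modnMDl modn_small.
- exists ord0, ord_max; rewrite tokenM /token -val_eqE /=.
  by case: ifP.
Qed.

End Counter.

Theorem theorem2 (n k : nat) :
  0 < k -> n = 5 * k + 4 -> 4 ^ k <= car n 3.
Proof.
move=> k_gt0 ->; case: k k_gt0 => [//|[|[|[|k]]]] _.
(* Cycle lengths 4 and 5, 5 and 9, 9 and 10 add up to 9, 14, 19 states; their products 20, 45, 90
   exceed 4, 16, 64. *)
- exact: leq_trans (@leq_car_cycles 3 4 _).
- exact: leq_trans (@leq_car_cycles 4 8 _).
- exact: leq_trans (@leq_car_cycles 8 9 _).
- apply: leq_trans (leq_car_counter k.+2).
  by rewrite [X in X <= _]expnS leq_mul2r orbT.
Qed.
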